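(* Let $A\in\mathbb{R}^{n\times n}$, let $\Xi,\Xi'\in\mathrm{SPD}(n)$, let $k\le n$, and let $(\Psi,\Phi)$ be the test and trial basis matrices of an inner-product balancing of $\Xi$ and $\Xi'$ of dimension $k$. If $A^{\tau}\Xi+\Xi A\prec 0$, or if $A\,\Xi'+\Xi'A^{\tau}\prec 0$, then the reduced-order model with system matrix $\tilde A=\Psi^{\tau}A\Phi$ is asymptotically stable, i.e. all eigenvalues of $\tilde A$ have strictly negative real part.
   Context: $\mathrm{SPD}(n)$ is the set of real symmetric positive-definite $n\times n$ matrices; $X\prec0$ means negative definite; $\tau$ denotes transpose. Inner-product balancing: given $\Xi,\Xi'\in\mathrm{SPD}(n)$ and $k\le n$, write $\Xi=RR^{\tau}$, $\Xi'=SS^{\tau}$ with $R,S\in\mathbb{R}^{n\times n}$, take a singular value decomposition $R^{\tau}S=U\Sigma V^{\tau}$ with singular values in decreasing order, and partition $U=[U_1\ U_2]$, $\Sigma=\mathrm{diag}(\Sigma_1,\Sigma_2)$, $V=[V_1\ V_2]$, where $U_1,V_1\in\mathbb{R}^{n\times k}$ have orthonormal columns and $\Sigma_1=\mathrm{diag}(\sigma_1,\ldots,\sigma_k)$ contains the $k$ largest singular values. The trial and test basis matrices are $\Phi=SV_1\Sigma_1^{-1/2}$ and $\Psi=RU_1\Sigma_1^{-1/2}$. *)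

(* Defs.v *)
From HB Require Import structures.
From mathcomp Require Export all_boot all_order all_algebra.
From mathcomp Require Export reals.
From mathcomp Require Export complex.

Set Implicit Arguments.
Unset Strict Implicit.
Unset Printing Implicit Defensive.

Import Order.TTheory GRing.Theory Num.Theory.

Local Open Scope ring_scope.

Definition SPD (R : realType) (n : nat) (X : 'M[R]_n) : Prop :=
  X \is symmetricmx /\
  forall x : 'cV[R]_n, x != 0 -> 0 < (x^T *m X *m x) 0 0.

Definition negative_definite (R : realType) (n : nat) (X : 'M[R]_n) : Prop :=
  X \is symmetricmx /\
  forall x : 'cV[R]_n, x != 0 -> (x^T *m X *m x) 0 0 < 0.

Definition orthogonal_matrix (R : realType) (n : nat) (Q : 'M[R]_n) : Prop :=
  Q^T *m Q = 1%:M.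

(* [s] lists the diagonal of Sigma. *)
Definition is_svd (R : realType) (n : nat)
    (M U : 'M[R]_n) (s : 'rV[R]_n) (V : 'M[R]_n) : Prop :=
  [/\ orthogonal_matrix U, orthogonal_matrix V,
      forall i, 0 <= s 0 i,
      forall i j : 'I_n, (i <= j)%N -> s 0 j <= s 0 i
    & M = U *m diag_mx s *m V^T].

Definition first_cols (R : realType) (m n k : nat) (hk : (k <= n)%N)
    (M : 'M[R]_(m, n)) : 'M[R]_(m, k) :=
  colsub (widen_ord hk) M.

(* When [s] has positive entries this is diag(s)^(-1/2). *)
Definition diag_inv_sqrt (R : realType) (k : nat) (s : 'rV[R]_k) : 'M[R]_k :=
  diag_mx (map_mx (fun x => (Num.sqrt x)^-1) s).

(* A relation, not a function: the factors and the singular value decomposition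
   are not unique. *)
Definition inner_product_balancing (R : realType) (n k : nat) (hk : (k <= n)%N)
    (Xi Xi' : 'M[R]_n) (Psi Phi : 'M[R]_(n, k)) : Prop :=
  exists (Rf Sf U V : 'M[R]_n) (s : 'rV[R]_n),
    [/\ Xi = Rf *m Rf^T,
        Xi' = Sf *m Sf^T,
        is_svd (Rf^T *m Sf) U s V,
        Psi = Rf *m first_cols hk U *m diag_inv_sqrt (first_cols hk s)
      & Phi = Sf *m first_cols hk V *m diag_inv_sqrt (first_cols hk s)].

Definition asymptotically_stable (R : realType) (k : nat) (M : 'M[R]_k) : Prop :=
  forall z : R[i],
    eigenvalue (map_mx (real_complex R) M) z -> complex.Re z < 0.

(* Main.v *)
Require Import Defs.
From mathcomp Require Import ring lra.

(** Let [D = diag(sigma_1, ..., sigma_k)].  The balancing gives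
    [Psi^T Phi = 1] and [Xi' Psi = Phi D], hence, with [M = Psi^T A Phi],
    [M D + D M^T = Psi^T (A Xi' + Xi' A^T) Psi]: if [A Xi' + Xi' A^T] is negative
    definite then [D] is a Lyapunov certificate for [M].  Transposing the
    singular value decomposition exchanges the roles of [(Xi, Psi)] and
    [(Xi', Phi)], so the other hypothesis gives the stability of
    [M^T = Phi^T A^T Psi] in the same way. *)

Set Implicit Arguments.
Unset Strict Implicit.
Unset Printing Implicit Defensive.

Import Order.TTheory GRing.Theory Num.Theory.

Local Open Scope ring_scope.

(** For a square matrix, a trivial left kernel amounts to invertibility, which transposition
    preserves. *)
Lemma eigenvalue_trmx (F : fieldType) (n : nat) (M : 'M[F]_n) (a : F) :
  eigenvalue M^T a = eigenvalue M a.
Proof.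
rewrite /eigenvalue /eigenspace !kermx_eq0 !row_free_unit.
by rewrite -[in RHS]unitmx_tr linearB /= tr_scalar_mx.
Qed.

(** * Real and imaginary parts of complex matrices *)

Section ReIm.
Variables (R : realType) (m n : nat) (v : 'M[R[i]]_(m, n)).

Lemma map_Re_mulmx p (M : 'M[R]_(n, p)) :
  map_mx (@complex.Re R) (v *m map_mx (real_complex R) M) =
  map_mx (@complex.Re R) v *m M.
Proof.
apply/matrixP => i j; rewrite !mxE.
rewrite (big_morph (@complex.Re R) (id1 := 0) (op1 := +%R)) //; last first.
  by case=> a b [].
by apply: eq_bigr => l _; rewrite !mxE; case: (v i l) => a b /=; ring.
Qed.

Lemma map_Im_mulmx p (M : 'M[R]_(n, p)) :
  map_mx (@complex.Im R) (v *m map_mx (real_complex R) M) =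
  map_mx (@complex.Im R) v *m M.
Proof.
apply/matrixP => i j; rewrite !mxE.
rewrite (big_morph (@complex.Im R) (id1 := 0) (op1 := +%R)) //; last first.
  by case=> a b [].
by apply: eq_bigr => l _; rewrite !mxE; case: (v i l) => a b /=; ring.
Qed.

Lemma map_Re_scale (z : R[i]) :
  map_mx (@complex.Re R) (z *: v) =
  complex.Re z *: map_mx (@complex.Re R) v
  - complex.Im z *: map_mx (@complex.Im R) v.
Proof.
by apply/matrixP => i j; rewrite !mxE; case: z (v i j) => x y [].
Qed.

Lemma map_Im_scale (z : R[i]) :
  map_mx (@complex.Im R) (z *: v) =
  complex.Re z *: map_mx (@complex.Im R) v
  + complex.Im z *: map_mx (@complex.Re R) v.
Proof.
by apply/matrixP => i j; rewrite !mxE; case: z (v i j) => x y [a b] /=; ring.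
Qed.

Lemma map_ReIm_eq0 :
  map_mx (@complex.Re R) v = 0 -> map_mx (@complex.Im R) v = 0 -> v = 0.
Proof.
move=> /matrixP re0 /matrixP im0; apply/matrixP => i j.
move: (re0 i j) (im0 i j); rewrite !mxE.
by case: (v i j) => a b /= -> ->.
Qed.

End ReIm.

(** * Stability and the Lyapunov criterion *)

Lemma asymptotically_stable_trmx (R : realType) (k : nat) (M : 'M[R]_k) :
  asymptotically_stable M^T -> asymptotically_stable M.
Proof. by move=> stM z; rewrite -eigenvalue_trmx map_trmx => /stM. Qed.

Lemma symmetricmxP (R : realType) (n : nat) (X : 'M[R]_n) :
  reflect (X^T = X) (X \is symmetricmx).
Proof.
by apply: (iffP (is_hermitianmxP _ _ _));
  rewrite expr0 scale1r map_mx_id // => /esym.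
Qed.

(* With [v = a + i b] a left eigenvector of [M] for [z = x + i y], the cross
   terms in [y] cancel and [q(a) + q(b) = 2 x (a P a^T + b P b^T)], where [q] is
   the quadratic form of [M P + P M^T]. *)
Lemma lyapunov_stable (R : realType) (k : nat) (M P : 'M[R]_k) :
  SPD P -> negative_definite (M *m P + P *m M^T) -> asymptotically_stable M.
Proof.
move=> [Psym Ppos] [_ Lneg] z /eigenvalueP [v vM vN0].
pose a := map_mx (@complex.Re R) v; pose b := map_mx (@complex.Im R) v.
have aM : a *m M = complex.Re z *: a - complex.Im z *: b.
  by rewrite -map_Re_mulmx vM map_Re_scale.
have bM : b *m M = complex.Re z *: b + complex.Im z *: a.
  by rewrite -map_Im_mulmx vM map_Im_scale.
have PT : P^T = P by apply/symmetricmxP.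
have formC (u w : 'rV[R]_k) : (u *m P *m w^T) 0 0 = (w *m P *m u^T) 0 0.
  by rewrite -[in LHS](trmxK u) -[in LHS]PT -mulmxA -!trmx_mul [LHS]mxE.
pose p (w : 'rV[R]_k) := (w *m P *m w^T) 0 0.
pose q (w : 'rV[R]_k) := (w *m (M *m P + P *m M^T) *m w^T) 0 0.
have p_gt0 w : w != 0 -> 0 < p w.
  by move=> wN0; have := Ppos w^T; rewrite trmxK trmx_eq0; apply.
have q_lt0 w : w != 0 -> q w < 0.
  by move=> wN0; have := Lneg w^T; rewrite trmxK trmx_eq0; apply.
(* The two summands of [q w] are transposes of each other, as [P] is symmetric. *)
have qE w : q w = 2 * (w *m M *m P *m w^T) 0 0.
  rewrite /q mulmxDr mulmxDl mxE !mulmxA.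
  rewrite -[w *m P *m _ *m _]mulmxA -trmx_mul [X in _ + X]formC; ring.
have sumq : q a + q b = 2 * complex.Re z * (p a + p b).
  have entryE x y (X Y : 'M[R]_1) : (x *: X + y *: Y) 0 0 = x * X 0 0 + y * Y 0 0.
    by rewrite !mxE.
  rewrite !qE aM bM -scaleNr !(mulmxDl, =^~ scalemxAl) !entryE -/(p a) -/(p b).
  by rewrite (formC b a); ring.
have p0 w : 0 <= p w.
  by have [->|/p_gt0/ltW //] := eqVneq w 0; rewrite /p !mul0mx mxE.
have q0 w : q w <= 0.
  by have [->|/q_lt0/ltW //] := eqVneq w 0; rewrite /q !mul0mx mxE.
(* If [a] or [b] is nonzero, then [q a + q b < 0 < p a + p b], and [sumq] forces the sign of
   [complex.Re z]. *)
have [a0|/[dup] /p_gt0 pa /q_lt0 qa] := eqVneq a 0; last first.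
  have := p0 b; have := q0 b; nra.
have [b0|/[dup] /p_gt0 pb /q_lt0 qb] := eqVneq b 0; last first.
  have := p0 a; have := q0 a; nra.
by rewrite (map_ReIm_eq0 a0 b0) eqxx in vN0.
Qed.

(** * Definite matrices *)

Lemma SPD_unitmx (R : realType) (n : nat) (X : 'M[R]_n) : SPD X -> X \in unitmx.
Proof.
move=> [_ Xpos]; rewrite -row_free_unit; apply: inj_row_free => v vX.
apply/eqP/negPn/negP => vN0.
have := Xpos v^T; rewrite trmx_eq0 trmxK vX mul0mx mxE ltxx.
by move=> /(_ vN0).
Qed.

Lemma SPD_diag_mx (R : realType) (k : nat) (d : 'rV[R]_k) :
  (forall i, 0 < d 0 i) -> SPD (diag_mx d).
Proof.
move=> d_gt0; split=> [|x xN0]; first by apply/symmetricmxP; rewrite tr_diag_mx.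
have formE : (x^T *m diag_mx d *m x) 0 0 = \sum_i d 0 i * x i 0 ^+ 2.
  by rewrite mul_mx_diag mxE; apply: eq_bigr => i _; rewrite !mxE; ring.
have ge0 i : 0 <= d 0 i * x i 0 ^+ 2 by rewrite mulr_ge0 ?sqr_ge0 // ltW.
rewrite formE lt_neqAle sumr_ge0 // andbT eq_sym.
apply: contra xN0 => /eqP/psumr_eq0P sum0; apply/eqP/matrixP => i j.
have /eqP := sum0 (fun i _ => ge0 i) i isT.
by rewrite mulf_eq0 gt_eqF //= sqrf_eq0 ord1 mxE => /eqP.
Qed.

(** The left inverse [C] makes [B] injective, so the form of [X] is evaluated at the nonzero vector
    [B *m x]. *)
Lemma negative_definite_congr (R : realType) (n k : nat) (X : 'M[R]_n)
    (B : 'M[R]_(n, k)) (C : 'M[R]_(k, n)) :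
  C *m B = 1%:M -> negative_definite X -> negative_definite (B^T *m X *m B).
Proof.
move=> CB [/symmetricmxP Xsym Xneg]; split=> [|x xN0].
  by apply/symmetricmxP; rewrite !trmx_mul trmxK Xsym mulmxA.
have -> : x^T *m (B^T *m X *m B) *m x = (B *m x)^T *m X *m (B *m x).
  by rewrite trmx_mul !mulmxA.
apply: Xneg; apply: contra_neq xN0 => Bx.
by rewrite -[x]mul1mx -CB -mulmxA Bx mulmx0.
Qed.

(** * Singular values and the balanced bases *)

Lemma is_svd_trmx (R : realType) (n : nat) (M U V : 'M[R]_n) (s : 'rV[R]_n) :
  is_svd M U s V -> is_svd M^T V s U.
Proof.
by case=> oU oV s0 sD ->; split; rewrite // !trmx_mul trmxK tr_diag_mx mulmxA.
Qed.

Lemma inner_product_balancingC (R : realType) (n k : nat) (hk : (k <= n)%N)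
    (Xi Xi' : 'M[R]_n) (Psi Phi : 'M[R]_(n, k)) :
  inner_product_balancing hk Xi Xi' Psi Phi ->
  inner_product_balancing hk Xi' Xi Phi Psi.
Proof.
move=> [Rf [Sf [U [V [s [XiE Xi'E svd PsiE PhiE]]]]]].
exists Sf, Rf, V, U, s; split=> //.
by have := is_svd_trmx svd; rewrite trmx_mul trmxK.
Qed.

(** The determinant of the diagonal factor is the product of the singular values, so none vanishes.
    This makes [diag_inv_sqrt] a genuine inverse square root. *)
Lemma is_svd_gt0 (R : realType) (n : nat) (M U V : 'M[R]_n) (s : 'rV[R]_n) :
  is_svd M U s V -> M \in unitmx -> forall i, 0 < s 0 i.
Proof.
move=> [_ _ s0 _ ->] unitM i; rewrite lt_neqAle s0 andbT eq_sym.
move: unitM; rewrite !unitmx_mul => /andP[/andP[_ +] _].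
by rewrite unitmxE det_diag unitfE => /prodf_neq0 /(_ i isT).
Qed.

Lemma diag_mx_first_cols (R : realType) (n k : nat) (hk : (k <= n)%N)
    (s : 'rV[R]_n) :
  diag_mx s *m first_cols hk 1%:M =
  first_cols hk 1%:M *m diag_mx (first_cols hk s).
Proof.
apply/matrixP => i j; rewrite mul_diag_mx mul_mx_diag !mxE.
by case: eqP => [->|_]; rewrite ?mulr0n ?mulr1n; ring.
Qed.

Lemma diag_inv_sqrtK (R : realType) (k : nat) (d : 'rV[R]_k) :
  (forall i, 0 < d 0 i) ->
  diag_inv_sqrt d *m diag_mx d *m diag_inv_sqrt d = 1%:M.
Proof.
move=> d_gt0; rewrite /diag_inv_sqrt !mulmx_diag -diag_const_mx; congr diag_mx.
apply/rowP => i; rewrite !mxE -{2}(sqr_sqrtr (ltW (d_gt0 i))).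
have : Num.sqrt (d 0 i) != 0 by rewrite gt_eqF // sqrtr_gt0.
by move=> ?; field.
Qed.

Lemma balancing_biorthogonal (R : realType) (n k : nat) (hk : (k <= n)%N)
    (Xi Xi' : 'M[R]_n) (Psi Phi : 'M[R]_(n, k)) :
  SPD Xi -> SPD Xi' -> inner_product_balancing hk Xi Xi' Psi Phi ->
  exists d : 'rV[R]_k,
    [/\ forall i, 0 < d 0 i, Psi^T *m Phi = 1%:M
      & Xi' *m Psi = Phi *m diag_mx d].
Proof.
move=> /SPD_unitmx + /SPD_unitmx +.
move=> + + [Rf [Sf [U [V [s [XiE Xi'E svd PsiE PhiE]]]]]].
(* Invertibility of [Xi] and [Xi'] passes to [Rf^T] and [Sf], hence to the decomposed matrix
   [Rf^T *m Sf]. *)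
rewrite XiE Xi'E !unitmx_mul => /andP[_ unitR] /andP[unitS _].
have s_gt0 : forall i, 0 < s 0 i.
  by apply: is_svd_gt0 svd _; rewrite unitmx_mul unitR.
have [oU oV _ _ svdE] := svd.
have svdET : Sf^T *m Rf = V *m diag_mx s *m U^T.
  by case: (is_svd_trmx svd) => _ _ _ _; rewrite trmx_mul trmxK.
(* Right multiplication by [E] truncates to [k] columns, which turns the block partition into matrix
   algebra. *)
pose E : 'M[R]_(n, k) := first_cols hk 1%:M.
have colsE (W : 'M[R]_n) : first_cols hk W = W *m E.
  by rewrite mulmx_colsub mulmx1.
have EE : E^T *m E = 1%:M.
  rewrite trmx_mxsub trmx1 -mxsub_mul mulmx1.
  by apply/matrixP => i j; rewrite !mxE -!val_eqE.
move: PsiE PhiE; set d := first_cols hk s; set T := diag_inv_sqrt d.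
rewrite !colsE => PsiE PhiE.
have d_gt0 i : 0 < d 0 i by rewrite mxE.
have sE : diag_mx s *m E = E *m diag_mx d by apply: diag_mx_first_cols.
exists d; split=> //.
  (* With [D = diag_mx d], the orthogonal factors cancel: [Psi^T Phi = T E^T U^T (Rf^T Sf) V E T = T
     D T = 1]. *)
  rewrite PsiE PhiE !trmx_mul tr_diag_mx.
  rewrite !mulmxA -[_ *m Rf^T *m Sf]mulmxA svdE !mulmxA.
  rewrite -[_ *m U^T *m U]mulmxA oU mulmx1 -[_ *m V^T *m V]mulmxA oV mulmx1.
  rewrite -[_ *m diag_mx s *m E]mulmxA sE mulmxA -[_ *m E^T *m E]mulmxA EE.
  by rewrite mulmx1 diag_inv_sqrtK.
(* Here [Xi' Psi = Sf (Sf^T Rf) U E T = Sf V E D T], and the diagonal matrices [D] and [T]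
   commute. *)
rewrite PsiE PhiE !mulmxA -[_ *m Sf^T *m Rf]mulmxA svdET !mulmxA.
rewrite -[_ *m U^T *m U]mulmxA oU mulmx1.
rewrite -[_ *m diag_mx s *m E]mulmxA sE mulmxA.
by rewrite -!mulmxA [in LHS]diag_mxC.
Qed.

Lemma balancing_stable (R : realType) (n k : nat) (hk : (k <= n)%N)
    (A Xi Xi' : 'M[R]_n) (Psi Phi : 'M[R]_(n, k)) :
  SPD Xi -> SPD Xi' -> inner_product_balancing hk Xi Xi' Psi Phi ->
  negative_definite (A *m Xi' + Xi' *m A^T) ->
  asymptotically_stable (Psi^T *m A *m Phi).
Proof.
move=> spdXi spdXi' bal negA.
have [d [d_gt0 biorth Xi'Psi]] := balancing_biorthogonal spdXi spdXi' bal.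
have Xi'sym : Xi'^T = Xi' by apply/symmetricmxP; case: spdXi'.
have PsiXi' : Psi^T *m Xi' = diag_mx d *m Phi^T.
  by rewrite -[in LHS]Xi'sym -trmx_mul Xi'Psi trmx_mul tr_diag_mx.
apply: lyapunov_stable (SPD_diag_mx d_gt0) _.
have -> : Psi^T *m A *m Phi *m diag_mx d + diag_mx d *m (Psi^T *m A *m Phi)^T =
          Psi^T *m (A *m Xi' + Xi' *m A^T) *m Psi.
  rewrite !trmx_mul trmxK mulmxDr mulmxDl !mulmxA PsiXi'.
  by rewrite -[_ *m Xi' *m Psi]mulmxA Xi'Psi !mulmxA.
(* Transposing [biorth] shows that [Phi^T] is a left inverse of [Psi]. *)
apply: (negative_definite_congr (C := Phi^T)) negA.
by rewrite -[Psi]trmxK -trmx_mul biorth trmx1.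
Qed.

Theorem corollary3p12 (R : realType) (n k : nat) (hk : (k <= n)%N)
    (A Xi Xi' : 'M[R]_n) (Psi Phi : 'M[R]_(n, k)) :
  SPD Xi -> SPD Xi' ->
  inner_product_balancing hk Xi Xi' Psi Phi ->
  negative_definite (A^T *m Xi + Xi *m A) \/
  negative_definite (A *m Xi' + Xi' *m A^T) ->
  asymptotically_stable (Psi^T *m A *m Phi).
Proof.
move=> spdXi spdXi' bal [negA|negA]; last exact: balancing_stable bal negA.
apply: asymptotically_stable_trmx; rewrite !trmx_mul trmxK mulmxA.
apply: balancing_stable (inner_product_balancingC bal) _ => //.
by rewrite trmxK.
Qed.
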